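(* Let $B$ be an $n\times n$ nonsingular totally nonnegative matrix and let $1\le k<n$. All order-$k$ minors of $B$ are positive if and only if $$\Delta_{L_k,R_k}(B)>0\quad\text{and}\quad \Delta_{R_k,L_k}(B)>0.$$
   Context: All matrices are real and have order $n\ge2$. A matrix is totally nonnegative if all its minors are $\ge0$. For $k$-subsets $I,J$ of $\{1,\dots,n\}$, $\Delta_{I,J}(B)=\det B[I,J]$ is the minor with row set $I$ and column set $J$ (in increasing order). $L_k=\{1,\dots,k\}$ and $R_k=\{n-k+1,\dots,n\}$. *)

(* Defs.v *)
From HB Require Import structures.
From mathcomp Require Import all_boot all_order all_algebra.
From mathcomp Require Import reals.

Set Implicit Arguments.
Unset Strict Implicit.
Unset Printing Implicit Defensive.

Import Order.TTheory GRing.Theory Num.Theory.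
Local Open Scope ring_scope.

(* Indices are 0-based: 'I_n stands for {1, ..., n} shifted down by one. *)

(* det B[I, J] for k-subsets I and J. On a set of ordinals enum_val is the
   increasing enumeration. When #|I| = #|J| = k, conform_mx only casts
   the submatrix from 'M_(#|I|, #|J|) to 'M_k; its default 0 is used only
   when the cardinals are wrong, a case excluded in all uses below. *)
Definition minor (R : comPzRingType) (n k : nat) (B : 'M[R]_n)
    (I J : {set 'I_n}) : R :=
  \det (conform_mx (0 : 'M[R]_k)
          (mxsub (@enum_val _ (mem I)) (@enum_val _ (mem J)) B)).

Definition totally_nonnegative (R : realType) (n : nat) (B : 'M[R]_n) : Prop :=
  forall (k : nat) (I J : {set 'I_n}),
    #|I| = k -> #|J| = k -> 0 <= minor k B I J.

Definition first_indices (n k : nat) : {set 'I_n} :=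
  [set i : 'I_n | (i < k)%N].

Definition last_indices (n k : nat) : {set 'I_n} :=
  [set i : 'I_n | (n - k <= i)%N].

(* Main.v *)
Require Import Defs.
From HB Require Import structures.
From mathcomp Require Import all_boot all_order all_algebra.
From mathcomp Require Import all_fingroup.
From mathcomp Require Import reals.
From mathcomp Require Import ring zify.

(** Write L and R for the first and the last k indices, and say that a pair
    (I, J) of k-sets is positive when the minor of B with rows I and columns J
    is.  Total nonnegativity enters only through minors of orders k - 1, k and
    k + 1, by way of the identity of Sylvester, or Desnanot and Jacobi,

      D(S+r, T+x) D(S+i, T+c) - D(S+r, T+c) D(S+i, T+x)
        = D(S+r+i, T+x+c) D(S, T)         (r < i and x < c)

    for sets S, T of size k - 1 ([minor_exchange]).  Its right-hand side is
    nonnegative, so if (S+r, T+c) and (S+i, T+x) are positive, then so are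
    (S+r, T+x) and (S+i, T+c) ([exchange_gt0]).  Two applications of this
    principle carry positivity from the two corners to all pairs.

    From a corner to an edge ([lower_row_gt0], [first_columns_gt0]).  If
    (S+i, L) is positive and r < i, then (S+r, L) is positive.  Otherwise the
    rows S+r are dependent on the columns L, with a linear relation y read off
    from the adjugate, in which row r really occurs because (S+i, L) is
    positive.  Since B is nonsingular, some column c outside L violates this
    relation, which makes (S+r, L-x+c) positive for a suitable x in L.  As L
    is initial, x < c, and the exchange principle makes (S+r, L) positive
    after all.  Trading the elements of R one by one for smaller ones then
    shows that (I, L) is positive for all I; on the transpose this gives
    (L, J) for all J.

    From the edges to everything ([minor_gt0_from_edges]).  If I and J both
    differ from L, replace an element of I, respectively of J, by an element
    of L.  By induction the two pairs obtained by changing only one of I and J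
    are positive, and they sit on the antidiagonal of an exchange whose
    largest pair is (I, J). *)

Set Implicit Arguments.
Unset Strict Implicit.
Unset Printing Implicit Defensive.

Import Order.TTheory GRing.Theory Num.Theory.
Local Open Scope ring_scope.

(** * The Desnanot-Jacobi identity *)

Definition replace_cols (R : comNzRingType) (m : nat) (M : 'M[R]_m)
    (u v : 'I_m) (z w : 'I_m -> R) : 'M[R]_m :=
  \matrix_(a, b) if b == u then z a else if b == v then w a else M a b.

(** Only the identity and the transposition of u and v contribute to the
    Leibniz expansion. *)
Lemma det_replace_cols1 (R : comNzRingType) (m : nat) (u v : 'I_m)
    (z w : 'I_m -> R) : u != v ->
  \det (replace_cols 1%:M u v z w) = z u * w v - z v * w u.
Proof.
move=> uv; rewrite /determinant (bigD1 1%g) //= (bigD1 (tperm u v)) /=; last first.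
  apply/eqP => E; have := congr1 (fun s : {perm _} => s u) E; rewrite tpermL perm1 => vu.
  by rewrite vu eqxx in uv.
have vu : (v == u) = false by rewrite eq_sym (negbTE uv).
rewrite [X in _ + (_ + X)]big1 => [|s /andP[s1 st]].
  rewrite odd_perm1 odd_tperm uv expr0 expr1 mul1r mulN1r addr0.
  congr (_ - _).
    rewrite (bigD1 u) //= (bigD1 v) /= ?vu //.
    rewrite !mxE !perm1 !eqxx vu big1 ?mulr1 // => i /andP[iu iv].
    by rewrite perm1 !mxE (negbTE iu) (negbTE iv) eqxx.
  rewrite (bigD1 u) //= (bigD1 v) /= ?vu //.
  rewrite !mxE tpermL tpermR !eqxx vu big1 ?mulr1 => [|i /andP[iu iv]].
    by rewrite mulrC.
  by rewrite tpermD 1?eq_sym // !mxE (negbTE iu) (negbTE iv) eqxx.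
(* Any other permutation moves some index outside {u, v}, where it meets an
   off-diagonal zero. *)
have [b /andP[bu bv] sb] : exists2 b, (b != u) && (b != v) & s b != b.
  apply/exists_inP; apply: contraT => /exists_inPn fix_s.
  have {}fix_s i : i != u -> i != v -> s i = i.
    move=> iu iv; apply/eqP; rewrite -[_ == _]negbK; apply: fix_s.
    by rewrite unfold_in iu iv.
  have [su|su] := eqVneq (s u) u.
    have sv : s v = v.
      apply/eqP; apply: contraT => sv.
      have svu : s v != u by rewrite -su (inj_eq perm_inj) vu.
      by have /perm_inj/eqP := fix_s (s v) svu sv; rewrite (negbTE sv).
    case/eqP: s1; apply/permP => i; rewrite perm1.
    by case: (eqVneq i u) => [->|iu] //; case: (eqVneq i v) => [->|iv] //; apply: fix_s.
  have suv : s u = v.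
    apply/eqP; apply: contraT => suv.
    by have /perm_inj/eqP := fix_s (s u) su suv; rewrite (negbTE su).
  have svu : s v = u.
    apply/eqP; apply: contraT => svu.
    have svv : s v != v by rewrite -{2}suv (inj_eq perm_inj) vu.
    by have /perm_inj/eqP := fix_s (s v) svu svv; rewrite (negbTE svv).
  case/eqP: st; apply/permP => i.
  by case: tpermP => [->|->|/eqP iu /eqP iv] //; apply: fix_s.
rewrite (bigD1 (s^-1 b)%g) //= permKV mxE.
rewrite (negbTE bu) (negbTE bv) mxE.
have /negbTE -> : (s^-1 b)%g != b.
  by apply: contra sb => /eqP {1}<-; rewrite permKV.
by rewrite mul0r mulr0.
Qed.

(** Jacobi's formula for the 2 x 2 minors of the adjugate.  Multiplying M by
    the identity matrix with columns u, v replaced by columns p, q of the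
    adjugate of M replaces the columns u, v of M by multiples of unit vectors;
    both sides of the resulting equality of determinants carry one spare
    factor det M, which is cancelled here. *)
Lemma cofactor_minor2_neq0 (R : idomainType) (m : nat) (M : 'M[R]_m)
    (p q u v : 'I_m) : u != v -> \det M != 0 ->
  cofactor M p u * cofactor M q v - cofactor M p v * cofactor M q u =
  \det M * \det (replace_cols M u v (fun a => (a == p)%:R) (fun a => (a == q)%:R)).
Proof.
move=> uv dM; apply: (mulfI dM).
set D := replace_cols M _ _ _ _.
have <- : \det (replace_cols 1%:M u v (fun a => (\adj M) a p) (fun a => (\adj M) a q))
   = cofactor M p u * cofactor M q v - cofactor M p v * cofactor M q u.
  by rewrite det_replace_cols1 // !mxE.
rewrite -det_mulmx.
pose d := \row_b (if (b == u) || (b == v) then \det M else 1).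
have -> : M *m replace_cols 1%:M u v (fun a => (\adj M) a p) (fun a => (\adj M) a q)
  = D *m diag_mx d.
  apply/matrixP => a b; rewrite mul_mx_diag !mxE.
  have adjE c : \sum_j M a j * (\adj M) j c = (a == c)%:R * \det M.
    have := congr1 (fun X : 'M_m => X a c) (mul_mx_adj M).
    by rewrite !mxE => ->; rewrite mulr_natl.
  case: (eqVneq b u) => [->|bu] /=.
    by rewrite -adjE; apply: eq_bigr => j _; rewrite !mxE eqxx.
  case: (eqVneq b v) => [->|bv] /=.
    rewrite -adjE; apply: eq_bigr => j _.
    by rewrite !mxE eqxx eq_sym (negbTE uv).
  rewrite mulr1 (bigD1 b) //= !mxE (negbTE bu) (negbTE bv) eqxx mulr1.
  rewrite big1 ?addr0 // => j jb.
  by rewrite !mxE (negbTE bu) (negbTE bv) (negbTE jb) mulr0.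
rewrite det_mulmx det_diag (bigD1 u) //= (bigD1 v) 1?eq_sym //= big1.
  by rewrite !mxE !eqxx orbT /=; ring.
by move=> i /andP[/negbTE iu /negbTE iv]; rewrite mxE iu iv.
Qed.

(** The identity is polynomial in the entries, so the case det M = 0 follows
    from the matrix X + M over the polynomial ring, whose determinant is
    nonzero since it is the characteristic polynomial of - M, by evaluating
    at X = 0. *)
Lemma cofactor_minor2 (R : idomainType) (m : nat) (M : 'M[R]_m)
    (p q u v : 'I_m) : u != v ->
  cofactor M p u * cofactor M q v - cofactor M p v * cofactor M q u =
  \det M * \det (replace_cols M u v (fun a => (a == p)%:R) (fun a => (a == q)%:R)).
Proof.
move=> uv.
pose N : 'M[{poly R}]_m := 'X%:M + map_mx polyC M.
have N0 : map_mx (horner_eval (0 : R)) N = M.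
  apply/matrixP => a b; rewrite !mxE /horner_eval.
  by rewrite hornerD hornerC hornerMn hornerX mul0rn add0r.
have dN : \det N != 0.
  have -> : N = char_poly_mx (- M) by rewrite /char_poly_mx map_mxN opprK.
  exact: monic_neq0 (char_poly_monic _).
have := congr1 (horner_eval (0 : R)) (cofactor_minor2_neq0 p q uv dN).
rewrite rmorphB !(rmorphM _ (cofactor _ _ _) (cofactor _ _ _)).
rewrite (rmorphM _ (\det _) (\det _)).
rewrite -!(cofactor_map_mx (horner_eval (0 : R)))
  -!(det_map_mx (horner_eval (0 : R))) N0.
congr (_ = _ * \det _) => //.
apply/matrixP => a b; rewrite [LHS]mxE /replace_cols !(@mxE _ _ _ matrix_key).
case: ifP => _; first by rewrite rmorph_nat.
case: ifP => _; first by rewrite rmorph_nat.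
by rewrite -[in RHS]N0 [RHS]mxE.
Qed.

(** The rows involved are p < lift p q and the columns u < lift u v, and with
    this order the signs of the cofactors agree on both sides.  Deleting
    through [lift] keeps the remaining rows and columns in increasing order. *)
Lemma desnanot_jacobi (R : idomainType) (m : nat) (M : 'M[R]_m.+2)
    (p u : 'I_m.+2) (q v : 'I_m.+1) : (p <= q)%N -> (u <= v)%N ->
  \det (mxsub (lift p) (lift u) M) *
    \det (mxsub (lift (lift p q)) (lift (lift u v)) M) -
  \det (mxsub (lift p) (lift (lift u v)) M) *
    \det (mxsub (lift (lift p q)) (lift u) M) =
  \det M * \det (mxsub (lift p \o lift q) (lift u \o lift v) M).
Proof.
move=> pq uv.
have cofE (i j : 'I_m.+2) :
  cofactor M i j = (-1) ^+ (i + j) * \det (mxsub (lift i) (lift j) M).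
  by rewrite /cofactor; congr (_ * \det _); apply/matrixP => a b; rewrite !mxE.
have := cofactor_minor2 M p (lift p q) (neq_lift u v).
set D := replace_cols _ _ _ _ _.
have -> : \det D =
  (-1) ^+ (p + u + q + v) * \det (mxsub (lift p \o lift q) (lift u \o lift v) M).
  rewrite (expand_det_col D u) (bigD1 p) //= big1 => [|i /negbTE ip]; last first.
    by rewrite !mxE eqxx ip mul0r.
  rewrite !mxE !eqxx mul1r addr0 /cofactor.
  rewrite (expand_det_col _ v) (bigD1 q) //= big1 => [|i iq]; last first.
    rewrite !mxE eqxx (inj_eq lift_inj) (negbTE iq) eq_sym.
    by rewrite (negbTE (neq_lift _ _)) mul0r.
  rewrite !mxE !eqxx [lift u v == u]eq_sym (negbTE (neq_lift _ _)) mul1r addr0 /cofactor.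
  rewrite mulrA -exprD addnA; congr (_ * \det _).
  apply/matrixP => a b; rewrite !mxE ![lift u _ == u]eq_sym.
  by rewrite (negbTE (neq_lift _ _)) (inj_eq lift_inj) eq_sym (negbTE (neq_lift _ _)).
rewrite !cofE /= /bump pq uv !add1n !addnS !addSn => H.
apply: (can_inj (signrMK (p + u + q + v))).
rewrite [RHS]mulrCA -H !exprS !exprD; ring.
Qed.

(** * Minors and increasing enumerations *)

Definition incr (k n : nat) (f : 'I_k -> 'I_n) : Prop :=
  {homo f : a b / (a < b)%N >-> (a < b)%N}.

Lemma incr_inj (k n : nat) (f : 'I_k -> 'I_n) : incr f -> injective f.
Proof.
move=> incf a b fab.
by case: (ltngtP a b) => [/incf|/incf|/val_inj //]; rewrite fab ltnn.
Qed.

Lemma incr_card (k n : nat) (f : 'I_k -> 'I_n) : incr f -> #|f @: setT| = k.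
Proof. by move=> /incr_inj fI; rewrite card_imset // cardsT card_ord. Qed.

(** An increasing function is determined by its image.  This is what makes
    [minor] independent of how the enumeration of an index set is built. *)
Lemma incr_eq (k n : nat) (f g : 'I_k -> 'I_n) :
  incr f -> incr g -> f @: setT = g @: setT -> f =1 g.
Proof.
pose lt m := [rel i j : 'I_m | (i < j)%N].
have lt_tr m : transitive (lt m) by move=> i j l; apply: ltn_trans.
have lt_irr m : irreflexive (lt m) by move=> i; rewrite /= ltnn.
have enum_sorted : sorted (lt k) (enum 'I_k).
  by have := iota_ltn_sorted 0 k; rewrite -val_enum_ord sorted_map.
have map_sorted (h : 'I_k -> 'I_n) : incr h -> sorted (lt n) (map h (enum 'I_k)).
  by move=> h_incr; apply: homo_sorted enum_sorted => a b; apply: h_incr.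
have mem_map_enum (h : 'I_k -> 'I_n) : map h (enum 'I_k) =i h @: setT.
  move=> i; apply/mapP/imsetP => -[a _ ->]; exists a; rewrite ?inE //.
  by rewrite mem_enum.
move=> incf incg fg a.
have /eq_in_map -> // : map f (enum 'I_k) = map g (enum 'I_k).
  apply: (irr_sorted_eq (lt_tr n) (lt_irr n)); [exact: map_sorted..|].
  by move=> i; rewrite !mem_map_enum fg.
by rewrite mem_enum.
Qed.

Definition enum_fun (k n : nat) (I : {set 'I_n}) (hI : #|I| = k) (a : 'I_k) : 'I_n :=
  enum_val (cast_ord (esym hI) a).

Lemma enum_fun_incr (k n : nat) (I : {set 'I_n}) (hI : #|I| = k) :
  incr (enum_fun hI).
Proof.
move=> a b ab; rewrite /enum_fun.
have I_gt0 : (0 < n)%N by apply: leq_ltn_trans (ltn_ord (enum_fun hI a)).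
rewrite !(enum_val_nth (Ordinal I_gt0)).
have sizeI c : (cast_ord (esym hI) c < size (enum I))%N by rewrite -cardE.
apply: (sorted_ltn_nth (leT := [rel i j : 'I_n | (i < j)%N])) => //.
- by move=> i j l; apply: ltn_trans.
- rewrite {1}/enum_mem -enumT; apply: sorted_filter => [i j l|]; first exact: ltn_trans.
  by have := iota_ltn_sorted 0 n; rewrite -val_enum_ord sorted_map.
- exact: sizeI.
- exact: sizeI.
Qed.

Lemma enum_fun_image (k n : nat) (I : {set 'I_n}) (hI : #|I| = k) :
  enum_fun hI @: setT = I.
Proof.
apply/eqP; rewrite eqEcard incr_card ?hI ?leqnn ?andbT; last exact: enum_fun_incr.
by apply/subsetP => _ /imsetP[a _ ->]; apply: enum_valP.
Qed.

(** Lets minors be computed with any increasing enumeration, in particular one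
    composed with [lift], without casts between cardinals. *)
Lemma minorE (R : comNzRingType) (n k : nat) (B : 'M[R]_n) (f g : 'I_k -> 'I_n) :
  incr f -> incr g -> minor k B (f @: setT) (g @: setT) = \det (mxsub f g B).
Proof.
move=> incf incg; set I := f @: setT; set J := g @: setT.
have hI : #|I| = k by apply: incr_card.
have hJ : #|J| = k by apply: incr_card.
have fE := incr_eq incf (enum_fun_incr hI) (esym (enum_fun_image hI)).
have gE := incr_eq incg (enum_fun_incr hJ) (esym (enum_fun_image hJ)).
rewrite /minor /conform_mx; case: eqP => [eI|/(_ hI) //].
case: eqP => [eJ|/(_ hJ) //].
rewrite (eq_irrelevance eI hI) (eq_irrelevance eJ hJ); congr (\det _).
apply/matrixP => a b.
by rewrite castmxE !mxE fE gE.
Qed.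

Lemma minor_trmx (R : comNzRingType) (n k : nat) (B : 'M[R]_n) (I J : {set 'I_n}) :
  #|I| = k -> #|J| = k -> minor k B^T I J = minor k B J I.
Proof.
move=> hI hJ; rewrite -(enum_fun_image hI) -(enum_fun_image hJ).
rewrite !minorE; try exact: enum_fun_incr.
by rewrite -det_tr; congr (\det _); apply/matrixP => a b; rewrite !mxE.
Qed.

(** For the question whether a minor vanishes, its rows and columns may be
    listed in any order. *)
Lemma det_mxsub_inj (R : comNzRingType) (n k : nat) (B : 'M[R]_n)
    (f g : 'I_k -> 'I_n) : injective f -> injective g ->
  exists b : bool,
    \det (mxsub f g B) = (-1) ^+ b * minor k B (f @: setT) (g @: setT).
Proof.
have sort_inj (h : 'I_k -> 'I_n) : injective h ->
    exists2 e : 'I_k -> 'I_n, incr e /\ e @: setT = h @: setT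
      & exists s : 'S_k, h =1 e \o s.
  move=> hI; have hC : #|h @: setT| = k by rewrite card_imset // cardsT card_ord.
  exists (enum_fun hC); first by split; [apply: enum_fun_incr|apply: enum_fun_image].
  have ex a : exists b, enum_fun hC b == h a.
    have : h a \in enum_fun hC @: setT by rewrite enum_fun_image imset_f.
    by case/imsetP => b _ ->; exists b.
  have sP a := eqP (xchooseP (ex a)).
  have sI : injective (fun a => xchoose (ex a)).
    by move=> a b ab; apply: hI; rewrite -!sP ab.
  by exists (perm sI) => a; rewrite /= permE sP.
move=> /sort_inj[e [ince <-] [s fE]] /sort_inj[e' [ince' <-] [t gE]].
exists (s (+) t); rewrite minorE //.
have -> : mxsub f g B = perm_mx s *m mxsub e e' B *m (perm_mx t)^T.
  rewrite tr_perm_mx -row_permE -[t in RHS]invgK -col_permE.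
  by apply/matrixP => a b; rewrite !mxE fE gE /= invgK.
by rewrite !det_mulmx det_tr !det_perm signr_addb mulrAC.
Qed.

(** * The exchange principle *)

Lemma lift_incr (n : nat) (p : 'I_n.+1) : incr (lift p).
Proof.
by move=> a b ab; rewrite ltnNge leq_bump2 -ltnNge.
Qed.

Lemma imset_lift (k n : nat) (f : 'I_k.+1 -> 'I_n) (p : 'I_k.+1) :
  injective f -> (f \o lift p) @: setT = (f @: setT) :\ f p.
Proof.
move=> fI; apply/setP => j; rewrite !inE; apply/imsetP/andP.
  move=> [a _ ->] /=; rewrite (inj_eq fI) eq_sym neq_lift; split=> //.
  exact: imset_f.
move=> [jp /imsetP[a _ ja]]; rewrite ja (inj_eq fI) in jp *.
by case: (unliftP p a) jp => [b ->|->]; [exists b|rewrite eqxx].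
Qed.

(** The four row sets of the exchange identity are obtained from the largest
    one by deleting the positions p of r and [lift p q] of i. *)
Lemma enum_setU2 (k n : nat) (S : {set 'I_n}) (r i : 'I_n) :
  #|S| = k -> r \notin S -> i \notin S -> (r < i)%N ->
  exists (f : 'I_k.+2 -> 'I_n) (p : 'I_k.+2) (q : 'I_k.+1),
    [/\ incr f, (p <= q)%N & [/\ f @: setT = r |: (i |: S),
      (f \o lift p) @: setT = i |: S,
      (f \o lift (lift p q)) @: setT = r |: S
    & (f \o (lift p \o lift q)) @: setT = S]].
Proof.
move=> hS rS iS ri.
have r_ne_i : r != i by apply: contraTneq ri => ->; rewrite ltnn.
have riS : r \notin i |: S by rewrite !inE negb_or r_ne_i.
have irS : i \notin r |: S by rewrite !inE negb_or eq_sym r_ne_i.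
have hE : #|r |: (i |: S)| = k.+2 by rewrite !cardsU1 riS iS hS.
have fincr := enum_fun_incr hE; have fE := enum_fun_image hE.
have fI := incr_inj fincr.
move: (enum_fun hE) fincr fE fI => f fincr fE fI.
have [p _ rp] : exists2 p, p \in setT & r = f p by apply/imsetP; rewrite fE setU11.
have [p2 _ ip] : exists2 p, p \in setT & i = f p.
  by apply/imsetP; rewrite fE setUCA setU11.
have pp2 : (p < p2)%N.
  rewrite ltnNge leq_eqVlt negb_or; apply/andP; split.
    by apply: contra r_ne_i => /eqP/val_inj p2p; rewrite rp ip p2p.
  by apply/negP => /fincr; rewrite -rp -ip ltnNge ltnW.
case: (unliftP p p2) => [q p2E|p2E]; last by rewrite p2E ltnn in pp2.
rewrite p2E in ip pp2.
have pq : (p <= q)%N.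
  by move: pp2; rewrite /= /bump; case: (leqP p q) => // qp; rewrite add0n ltnNge ltnW.
have E1 : (f \o lift p) @: setT = i |: S by rewrite imset_lift // fE -rp setU1K.
exists f, p, q; split=> //; split=> //.
  by rewrite imset_lift // fE -ip setUCA setU1K.
have -> : (f \o (lift p \o lift q)) @: setT = (f \o lift p \o lift q) @: setT.
  exact: eq_imset.
rewrite imset_lift ?E1 /= -?ip ?setU1K //.
by apply: inj_comp => //; apply: lift_inj.
Qed.

Lemma minor_exchange (R : idomainType) (n k : nat) (B : 'M[R]_n)
    (S T : {set 'I_n}) (r i x c : 'I_n) :
  #|S| = k -> r \notin S -> i \notin S -> (r < i)%N ->
  #|T| = k -> x \notin T -> c \notin T -> (x < c)%N ->
  minor k.+1 B (r |: S) (x |: T) * minor k.+1 B (i |: S) (c |: T) -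
  minor k.+1 B (r |: S) (c |: T) * minor k.+1 B (i |: S) (x |: T) =
  minor k.+2 B (r |: (i |: S)) (x |: (c |: T)) * minor k B S T.
Proof.
move=> hS rS iS ri hT xT cT xc.
have [f [p [q [incf pq [<- fi fr fS]]]]] := enum_setU2 hS rS iS ri.
have [g [u [v [incg uv [<- gc gx gT]]]]] := enum_setU2 hT xT cT xc.
rewrite -fi -fr -fS -gc -gx -gT (minorE B incf incg).
have minor_comp l (f' g' : 'I_l -> 'I_k.+2) : incr f' -> incr g' ->
    minor l B ((f \o f') @: setT) ((g \o g') @: setT) =
    \det (mxsub f' g' (mxsub f g B)).
  move=> incf' incg'; rewrite -mxsub_comp minorE // => a b.
    by move=> /incf'/incf.
  by move=> /incg'/incg.
have lift2_incr (a : 'I_k.+2) (b : 'I_k.+1) : incr (lift a \o lift b).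
  by move=> a' b' /(lift_incr b)/(lift_incr a).
rewrite !(minor_comp k.+1); try exact: lift_incr.
rewrite minor_comp; try exact: lift2_incr.
rewrite -desnanot_jacobi //.
by rewrite [X in X - _ = _]mulrC [X in _ - X = _]mulrC.
Qed.

(** A product of two positive minors on the antidiagonal bounds from below the
    product of the two nonnegative minors on the diagonal. *)
Lemma exchange_gt0 (R : realType) (n k : nat) (B : 'M[R]_n)
    (S T : {set 'I_n}) (r i x c : 'I_n) : totally_nonnegative B ->
  #|S| = k -> r \notin S -> i \notin S -> (r < i)%N ->
  #|T| = k -> x \notin T -> c \notin T -> (x < c)%N ->
  0 < minor k.+1 B (r |: S) (c |: T) -> 0 < minor k.+1 B (i |: S) (x |: T) ->
  0 < minor k.+1 B (r |: S) (x |: T) /\ 0 < minor k.+1 B (i |: S) (c |: T).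
Proof.
move=> B_TN hS rS iS ri hT xT cT xc rc_gt0 ix_gt0.
have card1 (U : {set 'I_n}) j : #|U| = k -> j \notin U -> #|j |: U| = k.+1.
  by move=> hU jU; rewrite cardsU1 jU hU.
have ge0 (a b : 'I_n) : a \notin S -> b \notin T -> 0 <= minor k.+1 B (a |: S) (b |: T).
  by move=> aS bT; apply: B_TN; apply: card1.
have card2 (U : {set 'I_n}) (j l : 'I_n) :
    #|U| = k -> j \notin U -> l \notin U -> (j < l)%N -> #|j |: (l |: U)| = k.+2.
  move=> hU jU lU jl; rewrite cardsU1 card1 // !inE negb_or jU andbT.
  by case: eqP jl => // ->; rewrite ltnn.
have : 0 < minor k.+1 B (r |: S) (x |: T) * minor k.+1 B (i |: S) (c |: T).
  apply: lt_le_trans (mulr_gt0 rc_gt0 ix_gt0) _.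
  rewrite -subr_ge0 minor_exchange //.
  by apply: mulr_ge0; apply: B_TN => //; apply: card2.
have := ge0 r x rS xT; have := ge0 i c iS cT.
rewrite !le_eqVlt => /predU1P[<-|->]; first by rewrite mulr0 ltxx.
by move=> /predU1P[<-|->] //; rewrite mul0r ltxx.
Qed.

(** * From the corners to all minors *)

Lemma card_first_indices (n k : nat) : (k <= n)%N -> #|first_indices n k| = k.
Proof.
move=> kn; have w_incr : incr (widen_ord kn) by [].
rewrite -[RHS](incr_card w_incr); congr #|pred_of_set _|.
apply/setP => i; rewrite inE; apply/idP/imsetP => [ik|[a _ ->]] //=.
by exists (Ordinal ik) => //; apply: val_inj.
Qed.

Lemma card_last_indices (n k : nat) : (k <= n)%N -> #|last_indices n k| = k.
Proof.
move=> kn; rewrite -[RHS](card_first_indices kn) -[RHS](card_imset _ rev_ord_inj).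
congr #|pred_of_set _|; apply/setP => i; rewrite inE; apply/idP/imsetP => [ik|[a]].
  exists (rev_ord i); rewrite ?rev_ordK // inE /=.
  by have := ltn_ord i; lia.
by rewrite inE => ak -> /=; have := ltn_ord a; lia.
Qed.

(** One step of the transformation of I into K; the strict decrease of
    I :\: K drives both inductions below. *)
Lemma set_swap (n k : nat) (I K : {set 'I_n}) :
  #|I| = k.+1 -> #|K| = k.+1 -> I != K ->
  exists (S : {set 'I_n}) (r i : 'I_n),
    [/\ I = r |: S, #|S| = k, r \notin S, i \notin S
      & [/\ r \notin K, i \in K & (#|(i |: S) :\: K| < #|I :\: K|)%N]].
Proof.
move=> hI hK IK.
have [r rI rK] : exists2 r, r \in I & r \notin K.
  by apply/subsetPn; apply: contra IK => sIK; rewrite eqEcard sIK hI hK /=.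
have [i iK iI] : exists2 i, i \in K & i \notin I.
  by apply/subsetPn; apply: contra IK => sKI; rewrite eq_sym eqEcard sKI hI hK /=.
exists (I :\ r), r, i; split; rewrite ?setD1K ?inE ?eqxx ?(negbTE iI) ?andbF //.
  by have := cardsD1 r I; rewrite rI hI => -[].
split=> //; apply: proper_card; apply/properP; split.
  apply/subsetP => j; rewrite !inE => /andP[jK /orP[/eqP ji|/andP[_ ->]]].
    by rewrite ji iK in jK.
  by rewrite jK.
by exists r; rewrite !inE ?rI ?rK // eqxx /= orbF; apply: contraNN iI => /eqP <-.
Qed.

(** This is the only place where nonsingularity is used: a relation between
    the rows r |: S on the first columns would have to be broken by some later
    column, and the exchange principle forbids that. *)
Lemma lower_row_gt0 (R : realType) (n k : nat) (B : 'M[R]_n)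
    (S : {set 'I_n}) (r i : 'I_n) :
  B \in unitmx -> totally_nonnegative B -> (k < n)%N ->
  #|S| = k -> r \notin S -> i \notin S -> (r < i)%N ->
  0 < minor k.+1 B (i |: S) (first_indices n k.+1) ->
  0 < minor k.+1 B (r |: S) (first_indices n k.+1).
Proof.
move=> B_unit B_TN kn hS rS iS ri.
have hI : #|r |: S| = k.+1 by rewrite cardsU1 rS hS.
have hL := card_first_indices kn.
set L := first_indices n k.+1 in hL * => pos_i.
rewrite lt_neqAle B_TN // andbT eq_sym; apply/negP => /eqP minor0.
have f_incr := enum_fun_incr hI; have fE := enum_fun_image hI.
have g_incr := enum_fun_incr hL; have gE := enum_fun_image hL.
move: (enum_fun hI) f_incr fE (enum_fun hL) g_incr gE => f f_incr fE g g_incr gE.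
have f_inj := incr_inj f_incr; have g_inj := incr_inj g_incr.
have [p _ rp] : exists2 p, p \in setT & r = f p by apply/imsetP; rewrite fE setU11.
have mem_f a : f a \in r |: S by rewrite -fE imset_f.
have mem_g b : g b \in L by rewrite -gE imset_f.
have r_ne_i : r != i by apply: contraTneq ri => ->; rewrite ltnn.
pose N := mxsub f g B.
have detN : \det N = 0 by rewrite -minorE // fE gE.
(* Enumerates i |: S with i at the position p of r, so that both submatrices
   have the same cofactors along row p. *)
pose f' a := if a == p then i else f a.
have f'_neq a : a != p -> f a != i.
  move=> ap; apply: contra iS => /eqP fai; have := mem_f a.
  by rewrite fai !inE eq_sym (negbTE r_ne_i).
have f'_inj : injective f'.
  move=> a b; rewrite /f'; case: eqP => [->|/eqP ap]; case: eqP => [->|/eqP bp] //.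
  - by move=> /esym/eqP; rewrite (negbTE (f'_neq _ bp)).
  - by move=> /eqP; rewrite (negbTE (f'_neq _ ap)).
  - exact: f_inj.
have f'E : f' @: setT = i |: S.
  apply/eqP; rewrite eqEcard card_imset // cardsT card_ord cardsU1 iS hS leqnn andbT.
  apply/subsetP => _ /imsetP[a _ ->]; rewrite /f'; case: eqP => [_|/eqP ap].
    exact: setU11.
  have := mem_f a; rewrite !inE rp (inj_eq f_inj) (negbTE ap) /= => ->.
  by rewrite orbT.
(* Column x of L is chosen so that row p has a nonzero coefficient in the
   linear relation z between the rows of N. *)
have [x zx] : exists x, cofactor N p x != 0.
  apply/existsP; apply: contraT; rewrite negb_exists => /forallP cof0.
  have [b] := det_mxsub_inj B f'_inj g_inj; rewrite f'E gE.
  rewrite (expand_det_row _ p) big1 => [/esym/eqP|x _].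
    by rewrite mulf_eq0 signr_eq0 /= (gt_eqF pos_i).
  have := cof0 x; rewrite negbK => /eqP cofN.
  have -> : cofactor (mxsub f' g B) p x = cofactor N p x.
    rewrite /cofactor; congr (_ * \det _); apply/matrixP => a b'.
    by rewrite !mxE /f' eq_sym (negbTE (neq_lift _ _)).
  by rewrite cofN mulr0.
pose z : 'rV[R]_k.+1 := \row_a cofactor N a x.
(* y extends z by zero to a relation between all the rows of B. *)
pose y := z *m rowsub f 1%:M.
have yB0 : y *m B = 0.
  have -> : y *m B = z *m rowsub f B.
    by rewrite -mulmxA; congr (_ *m _); rewrite mul_rowsub_mx mul1mx.
  apply/rowP => c; rewrite !mxE.
  have [|cL] := boolP (c \in L).
    rewrite -gE => /imsetP[b _ ->].
    have := congr1 (fun X : 'M_k.+1 => X x b) (mul_adj_mx N).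
    rewrite detN !mxE mul0rn => relation; rewrite -[RHS]relation.
    by apply: eq_bigr => a _; rewrite !mxE.
  (* Value of the relation on a column c outside L: up to sign it is the minor
     of B on r |: S in which c takes the place of column x. *)
  pose g' b := if b == x then c else g b.
  have g'_neq b : g b != c by apply: contra cL => /eqP <-.
  have g'_inj : injective g'.
    move=> a b; rewrite /g'; case: eqP => [->|_]; case: eqP => [->|_] //.
    - by move=> /esym/eqP; rewrite (negbTE (g'_neq _)).
    - by move=> /eqP; rewrite (negbTE (g'_neq _)).
    - exact: g_inj.
  pose T := L :\ g x.
  have TE : g x |: T = L by rewrite setD1K.
  have hT : #|T| = k by have := cardsD1 (g x) L; rewrite mem_g hL => -[].
  have xT : g x \notin T by rewrite !inE eqxx.
  have cT : c \notin T by rewrite in_setD1 (negbTE cL) andbF.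
  have xc : (g x < c)%N.
    by have := mem_g x; move: cL; rewrite !inE -leqNgt; lia.
  have g'E : g' @: setT = c |: T.
    apply/eqP; rewrite eqEcard card_imset // cardsT card_ord cardsU1 cT hT leqnn andbT.
    apply/subsetP => _ /imsetP[b _ ->]; rewrite /g'; case: eqP => [_|/eqP bx].
      exact: setU11.
    by rewrite in_setU1 in_setD1 mem_g (inj_eq g_inj) bx orbT.
  have detg' : \det (mxsub f g' B) = \sum_a z 0 a * B (f a) c.
    rewrite (expand_det_col _ x); apply: eq_bigr => a _.
    rewrite mulrC !mxE /g' eqxx; congr (_ * _).
    rewrite /cofactor; congr (_ * \det _); apply/matrixP => a' b.
    by rewrite !mxE [_ == x]eq_sym (negbTE (neq_lift _ _)).
  transitivity (\det (mxsub f g' B)).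
    by rewrite detg'; apply: eq_bigr => a _; rewrite !mxE.
  have [b ->] := det_mxsub_inj B f_inj g'_inj; rewrite fE g'E.
  have : 0 <= minor k.+1 B (r |: S) (c |: T).
    by apply: B_TN => //; rewrite cardsU1 cT hT.
  rewrite le_eqVlt => /predU1P[<-|pos_c]; first by rewrite mulr0.
  rewrite -TE in pos_i minor0.
  have [] := exchange_gt0 B_TN hS rS iS ri hT xT cT xc pos_c pos_i.
  by rewrite minor0 ltxx.
have y0 : y = 0 by rewrite -(mulmxK B_unit y) yB0 mul0mx.
have := congr1 (fun v : 'rV_n => v 0 (f p)) y0.
rewrite !mxE (bigD1 p) //= !mxE eqxx mulr1 big1 => [|a ap].
  by move/eqP; rewrite addr0 (negbTE zx).
by rewrite !mxE (inj_eq f_inj) (negbTE ap) mulr0.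
Qed.

(** Every index outside R is smaller than every index in R, so any swap from I
    towards R trades a smaller index for a larger one. *)
Lemma first_columns_gt0 (R : realType) (n k : nat) (B : 'M[R]_n) :
  B \in unitmx -> totally_nonnegative B -> (k < n)%N ->
  0 < minor k.+1 B (last_indices n k.+1) (first_indices n k.+1) ->
  forall I : {set 'I_n}, #|I| = k.+1 ->
  0 < minor k.+1 B I (first_indices n k.+1).
Proof.
move=> B_unit B_TN kn corner I; have hR := card_last_indices kn.
have [m] := ubnP #|I :\: last_indices n k.+1|; elim: m I => // m IHm I Im hI.
have [->//|IR] := eqVneq I (last_indices n k.+1).
have [S [r [i [IE hS rS iS [rR iR lt]]]]] := set_swap hI hR IR.
have ri : (r < i)%N by move: rR iR; rewrite !inE -ltnNge; apply: leq_trans.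
rewrite IE; apply: (lower_row_gt0 B_unit B_TN kn hS rS iS ri).
by apply: IHm; [exact: leq_trans lt _ | rewrite cardsU1 iS hS].
Qed.

(** Every index outside L exceeds every index in L, so the swaps of rows and
    of columns go in the same direction and (I, J) is on the diagonal of the
    exchange. *)
Lemma minor_gt0_from_edges (R : realType) (n k : nat) (B : 'M[R]_n)
    (L := first_indices n k.+1) :
  totally_nonnegative B -> (k < n)%N ->
  (forall I : {set 'I_n}, #|I| = k.+1 -> 0 < minor k.+1 B I L) ->
  (forall J : {set 'I_n}, #|J| = k.+1 -> 0 < minor k.+1 B L J) ->
  forall I J : {set 'I_n}, #|I| = k.+1 -> #|J| = k.+1 -> 0 < minor k.+1 B I J.
Proof.
move=> B_TN kn cols rows I J; have hL : #|L| = k.+1 by apply: card_first_indices.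
have [m] := ubnP (#|I :\: L| + #|J :\: L|)%N; elim: m I J => // m IHm I J IJm hI hJ.
have [->|IL] := eqVneq I L; first exact: rows.
have [->|JL] := eqVneq J L; first exact: cols.
have [S [i [r [IE hS iS rS [iL rL ltI]]]]] := set_swap hI hL IL.
have [T [c [x [JE hT cT xT [cL xL ltJ]]]]] := set_swap hJ hL JL.
have ri : (r < i)%N by move: iL rL; rewrite !inE; lia.
have xc : (x < c)%N by move: cL xL; rewrite !inE; lia.
rewrite IE JE in IJm ltI ltJ *.
apply: (proj2 (exchange_gt0 B_TN hS rS iS ri hT xT cT xc _ _)).
- apply: IHm; rewrite ?cardsU1 ?rS ?hS ?cT ?hT //.
  by rewrite -ltnS; apply: leq_ltn_trans IJm; rewrite ltn_add2r.
- apply: IHm; rewrite ?cardsU1 ?iS ?hS ?xT ?hT //.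
  by rewrite -ltnS; apply: leq_ltn_trans IJm; rewrite ltn_add2l.
Qed.

Theorem theorem4p1 (R : realType) (n : nat) (hn : (2 <= n)%N) (B : 'M[R]_n)
    (B_nonsing : B \in unitmx) (B_TN : totally_nonnegative B)
    (k : nat) (hk : (1 <= k < n)%N) :
  (forall I J : {set 'I_n}, #|I| = k -> #|J| = k -> 0 < minor k B I J) <->
  (0 < minor k B (first_indices n k) (last_indices n k) /\
   0 < minor k B (last_indices n k) (first_indices n k)).
Proof.
case: k hk => // k /= /ltnW kn.
have hL := card_first_indices kn; have hR := card_last_indices kn.
split=> [pos|[pos_LR pos_RL]]; first by split; apply: pos.
apply: minor_gt0_from_edges => // [|J hJ]; first exact: first_columns_gt0.
rewrite -minor_trmx //; apply: first_columns_gt0 => //.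
- by rewrite unitmx_tr.
- by move=> l I K hI hK; rewrite minor_trmx //; apply: B_TN.
- by rewrite minor_trmx.
Qed.
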